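(* Let $p_n=p(n)$ denote the number of partitions of $n$ and $\sigma_n=\sigma(n)$ the sum of the positive divisors of $n$. For every integer $n\ge1$: (i) $n!\,p_n=|J_n(\overline{\sigma})|$; (ii) $\sigma_n=(-1)^{n-1}|H_n(\overline{p})|$; (iii) $p_n=\sum_{|\lambda|=n}z_\lambda^{-1}\sigma_\lambda$, the sum running over all partitions $\lambda$ of $n$.
   Context: $|M|$ denotes the determinant of a square matrix $M$. For a sequence $\overline{j}=(j_1,j_2,\dots)$, $J_n(\overline{j})$ is the $n\times n$ matrix whose $(i,k)$ entry is $j_{i-k+1}$ for $1\le k\le i\le n$, is $-i$ for $k=i+1$, and is $0$ for $k>i+1$. For a sequence $\overline{h}=(h_0,h_1,h_2,\dots)$ with $h_0=1$, $H_n(\overline{h})$ is the $n\times n$ matrix whose first column has entries $i\,h_i$ ($1\le i\le n$), whose $(i,k)$ entry is $h_{i-k+1}$ for $2\le k\le i$, is $1$ for $k=i+1$, and is $0$ for $k>i+1$. A partition $\lambda$ is a non-increasing sequence $(\lambda_1,\lambda_2,\dots)$ of non-negative integers with finitely many non-zero terms; $|\lambda|=\sum_i\lambda_i$; $m_k(\lambda)$ is the number of parts of $\lambda$ equal to $k$; $z_\lambda=\prod_{k\ge1}k^{m_k(\lambda)}m_k(\lambda)!$; and $\sigma_\lambda=\prod_i\sigma_{\lambda_i}$, the product being over the positive parts of $\lambda$. Here $p(0)=1$. *)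

(* Defs.v *)
From HB Require Import structures.
From mathcomp Require Import all_boot all_order all_algebra.

Set Implicit Arguments.
Unset Strict Implicit.
Unset Printing Implicit Defensive.

Import GRing.Theory.

(* The sequence (lambda_1, lambda_2, ...) is stored as its first n terms.
   This loses nothing: a partition of n has at most n non-zero terms, and each
   term is at most n. *)
Definition partitions (n : nat) : {set n.-tuple 'I_n.+1} :=
  [set l : n.-tuple 'I_n.+1 |
    sorted geq (map val l) && (sumn (map val l) == n)].

Definition npartitions (n : nat) : nat := #|partitions n|.

Definition sigma (n : nat) : nat := \sum_(d <- divisors n) d.

Definition multiplicity (k : nat) (s : seq nat) : nat := count_mem k s.

(* The product over all k >= 1: a part never exceeds the sum of the parts, so
   the omitted factors are all 1. *)
Definition zpart (s : seq nat) : nat :=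
  \prod_(1 <= k < (sumn s).+1) (k ^ multiplicity k s * (multiplicity k s)`!).

Definition sigma_part (s : seq nat) : nat := \prod_(k <- s | 0 < k) sigma k.

Local Open Scope ring_scope.

(* Rows and columns are numbered from 0, so row i (column k) is row i + 1
   (column k + 1) of the usual 1-based description. *)
Definition Jmx (R : pzRingType) (n : nat) (j : nat -> R) : 'M[R]_n :=
  \matrix_(i < n, k < n)
    if (k <= i)%N then j (i - k).+1
    else if k == i.+1 :> nat then - i.+1%:R
    else 0.

Definition Hmx (R : pzRingType) (n : nat) (h : nat -> R) : 'M[R]_n :=
  \matrix_(i < n, k < n)
    if k == 0%N :> nat then i.+1%:R * h i.+1
    else if (k <= i)%N then h (i - k).+1
    else if k == i.+1 :> nat then 1
    else 0.

(* Main.v *)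
(* Everything follows from n p_n = sum_(1 <= k <= n) sigma_k p_(n-k). To get it,
   write n as the sum over k of k m_k(lambda) for each partition lambda of n;
   removing one part k is a bijection from the partitions of n with m_k > 0 to
   those of n - k, so the sum of m_k over the partitions of n is the sum of
   p_(n-i) over the multiples i of k.  The same bijection shows that the sum of
   sigma_lambda / z_lambda satisfies the same recurrence, since
   k m_k(lambda) / z_lambda = 1 / z_(lambda minus k), which gives (iii).
   For (i) and (ii), the recurrence says that J_n (resp. H_n) maps the column
   (p_0, ..., p_(n-1)) (resp. (1, -sigma_1, ..., -sigma_(n-1))) to a multiple of
   the last basis vector, which determines the determinant. *)
Require Import Defs.
From HB Require Import structures.
From mathcomp Require Import all_boot all_order all_algebra.

Set Implicit Arguments.
Unset Strict Implicit.
Unset Printing Implicit Defensive.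

Import GRing.Theory Num.Theory.
Local Open Scope ring_scope.

(** * Determinants of Hessenberg matrices *)

Lemma det_hessenberg (R : comNzRingType) (n : nat) (A : 'M[R]_n.+1)
    (v : 'cV[R]_n.+1) (c : R) :
    (forall i k : 'I_n.+1, (i.+1 < k)%N -> A i k = 0) ->
    v ord0 0 = 1 ->
    (forall i, (A *m v) i 0 = if i == ord_max then c else 0) ->
  \det A =
  (-1) ^+ n * c * \prod_(i < n) A (widen_ord (leqnSn n) i) (lift ord0 i).
Proof.
move=> Ahess v0 Av.
(* Row 0 of adj(A) A v = det(A) v: only the cofactor of the bottom left entry
   survives, and its minor is lower triangular. *)
have /matrixP/(_ ord0 0) : \adj A *m (A *m v) = (\det A)%:M *m v.
  by rewrite mulmxA mul_adj_mx.
rewrite mul_scalar_mx !mxE v0 mulr1 => <-.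
rewrite (bigD1 ord_max) //= big1 ?addr0 => [|i /negbTE ni]; last first.
  by rewrite Av ni mulr0.
rewrite Av eqxx mxE /cofactor addn0 /= mulrAC; congr (_ * _).
have minorE (i k : 'I_n) : row' ord_max (col' ord0 A) i k =
    A (widen_ord (leqnSn n) i) (lift ord0 k).
  rewrite !mxE; congr (A _ _); apply: val_inj.
  by rewrite /= /bump leqNgt ltn_ord.
rewrite det_trig; last first.
  by apply/is_trig_mxP => i k ltik; rewrite minorE Ahess.
by apply: eq_bigr => i _; rewrite minorE.
Qed.

(** * Partitions as sorted lists of positive parts *)

Lemma geq_trans : transitive geq.
Proof. exact: rev_trans leq_trans. Qed.

Lemma geq_anti : antisymmetric geq.
Proof. by move=> i k; rewrite andbC => /anti_leq. Qed.

Lemma geq_total : total geq.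
Proof. by move=> i k; apply: leq_total. Qed.

Definition posparts (s : seq nat) : seq nat := [seq k <- s | (0 < k)%N].

(* The partitions of n without the trailing zeros, so that inserting and
   removing parts does not involve the padding. *)
Definition parts (n : nat) : seq (seq nat) :=
  [seq posparts (map val l) | l : n.-tuple 'I_n.+1 <- enum (partitions n)].

Lemma sumn_posparts (s : seq nat) : sumn (posparts s) = sumn s.
Proof. by elim: s => //= -[|k] s IHs //=; rewrite IHs. Qed.

(** In a non-increasing list the zeros come last, so the positive parts and the length determine the
    list; hence [parts] has no duplicates. *)
Lemma posparts_pad (s : seq nat) :
  sorted geq s -> s = posparts s ++ nseq (size s - size (posparts s)) 0%N.
Proof.
elim: s => //= k s IHs sks.
have /IHs {}IHs := path_sorted sks.
case: k sks => [|k] /= sks; last by rewrite subSS -IHs.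
have s0 : all (pred1 0%N) s.
  have /order_path_min := sks; move=> /(_ geq_trans).
  by apply: sub_all => k /=; rewrite leqn0.
have -> : posparts s = [::].
  apply/eqP; rewrite -(negbK (_ == _)) -has_filter -all_predC.
  by apply: sub_all s0 => k /eqP ->.
by rewrite subn0 /=; congr (_ :: _); apply/all_pred1P.
Qed.

Lemma parts_uniq (n : nat) : uniq (parts n).
Proof.
rewrite map_inj_in_uniq ?enum_uniq // => l1 l2.
rewrite !mem_enum !inE => /andP[s1 _] /andP[s2 _] e12.
apply/val_inj/(inj_map val_inj).
by rewrite /= (posparts_pad s1) (posparts_pad s2) e12 !size_map !size_tuple.
Qed.

Lemma size_parts (n : nat) : size (parts n) = npartitions n.
Proof. by rewrite size_map -cardE. Qed.

Lemma size_le_sumn (s : seq nat) : 0%N \notin s -> (size s <= sumn s)%N.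
Proof.
elim: s => //= k s IHs; rewrite inE negb_or eq_sym -lt0n => /andP[k0 /IHs].
by rewrite -add1n; apply: leq_add.
Qed.

Lemma mem_le_sumn (s : seq nat) (k : nat) : k \in s -> (k <= sumn s)%N.
Proof.
elim: s => //= i s IHs; rewrite inE => /predU1P[->|/IHs]; first exact: leq_addr.
by move=> /leq_trans; apply; apply: leq_addl.
Qed.

Lemma mem_parts (n : nat) (s : seq nat) :
  (s \in parts n) = [&& sorted geq s, 0%N \notin s & sumn s == n].
Proof.
apply/mapP/and3P => [[l]|[ss s0 /eqP sn]].
  rewrite mem_enum inE => /andP[sl /eqP ln] ->; split.
  - exact: (sorted_filter geq_trans).
  - by rewrite mem_filter.
  - by rewrite sumn_posparts ln.
(* Padding to length n is possible because positive integers summing to n number at most n. *)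
pose t := s ++ nseq (n - size s) 0%N.
have szt : size t = n.
  by rewrite size_cat size_nseq subnKC // -sn size_le_sumn.
have tn k : k \in t -> (k < n.+1)%N.
  by rewrite mem_cat => /orP[/mem_le_sumn|/nseqP[->]//]; rewrite sn.
have szl : size [seq inord k : 'I_n.+1 | k <- t] == n by rewrite size_map szt.
have vall : map val (Tuple szl) = t.
  rewrite /= -map_comp -[RHS]map_id; apply/eq_in_map => k /tn kn /=.
  by rewrite inordK.
exists (Tuple szl); rewrite ?mem_enum ?inE vall.
  rewrite sumn_cat sn sumn_nseq mul0n addn0 eqxx andbT.
  rewrite /t; elim: (s) (n - _)%N ss => [[|m] _|k s' IHs m] //=.
    by elim: m => //= m ->.
  rewrite !(path_sortedE geq_trans) => /andP[ks /(IHs m) ->].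
  by rewrite andbT all_cat ks all_nseq orbT.
rewrite /posparts filter_cat [X in _ ++ X](_ : _ = [::]) ?cats0.
  apply/esym/all_filterP/allP => k ks; rewrite lt0n.
  by apply: contraNneq s0 => <-.
by elim: (_ - _)%N.
Qed.

(** * Inserting and removing one part *)

Definition insert_part (k : nat) (s : seq nat) : seq nat := sort geq (k :: s).

Lemma perm_insert_part (k : nat) (s : seq nat) :
  perm_eq (insert_part k s) (k :: s).
Proof. by rewrite perm_sort. Qed.

(** The inverse of the insertion is [rem k]. Sorted lists with the same parts are equal, so lists
    need only be compared up to permutation. *)
Lemma perm_parts_insert (n k : nat) : (0 < k <= n)%N ->
  perm_eq [seq s <- parts n | k \in s] (map (insert_part k) (parts (n - k))).
Proof.
move=> /andP[k0 kn]; apply: uniq_perm.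
- exact/filter_uniq/parts_uniq.
- rewrite map_inj_in_uniq ?parts_uniq // => s1 s2.
  rewrite !mem_parts => /and3P[ss1 _ _] /and3P[ss2 _ _] e12.
  apply: (sorted_eq geq_trans geq_anti ss1 ss2).
  rewrite -(perm_cons k) -(permPl (perm_insert_part k s1)) e12.
  exact: perm_insert_part.
move=> s; rewrite mem_filter mem_parts; apply/idP/mapP => [|[s']].
  case/and4P => ks ss s0 /eqP sn; have prem := perm_to_rem ks.
  exists (rem k s).
    rewrite mem_parts (subseq_sorted geq_trans (rem_subseq k s) ss) /=.
    rewrite (contra (@mem_rem _ k s 0%N)) //=.
    by rewrite -sn (perm_sumn prem) /= addKn.
  apply: (sorted_eq geq_trans geq_anti ss).
    exact: (sort_sorted geq_total).
  by rewrite (permPl prem) perm_sym perm_insert_part.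
rewrite mem_parts => /and3P[ss' s0 /eqP sn] ->.
rewrite !(perm_mem (perm_insert_part k s')) mem_head /=.
rewrite (sort_sorted geq_total) inE negb_or eq_sym -lt0n k0 s0 /=.
by rewrite (perm_sumn (perm_insert_part k s')) /= sn subnKC.
Qed.

(** * The recurrence for the partition numbers *)

Lemma sumn_count (s : seq nat) (n : nat) : (sumn s <= n)%N ->
  sumn s = (\sum_(1 <= k < n.+1) k * count_mem k s)%N.
Proof.
elim: s => [|i s IHs] /= le_n; first by rewrite big1 // => k _; rewrite muln0.
under eq_bigr do rewrite mulnDr.
rewrite big_split /= -IHs; last exact: leq_trans (leq_addl _ _) le_n.
congr (_ + _)%N; case: i le_n => [|i] le_n.
  by rewrite big_nat_cond big1 // => -[|k]; rewrite // muln0.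
rewrite (bigD1_seq i.+1) ?iota_uniq ?mem_index_iota //=; last first.
  by rewrite ltnS (leq_trans _ le_n) // leq_addr.
rewrite eqxx muln1 big1 ?addn0 // => k /negbTE; rewrite eq_sym => ->.
by rewrite muln0.
Qed.

(** Partitions without k contribute 0; the others arise by inserting k, which raises its
    multiplicity by one. Used with F constantly 1 and with F = [weight]. *)
Lemma sum_count_parts (R : pzRingType) (n k : nat) (F : seq nat -> R) :
    (0 < k <= n)%N ->
  \sum_(s <- parts n) (count_mem k s)%:R * F s =
  \sum_(s <- parts (n - k)) (count_mem k s).+1%:R * F (insert_part k s).
Proof.
move=> kn; rewrite (bigID (fun s => k \in s)) /= addrC big1 ?add0r; last first.
  by move=> s /count_memPn ->; rewrite mul0r.
rewrite -big_filter (perm_big _ (perm_parts_insert kn)) big_map.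
by apply: eq_bigr => s _; rewrite (permP (perm_insert_part k s)) /= eqxx.
Qed.

Lemma sum_parts_mul (R : pzRingType) (n : nat) (F : seq nat -> R) :
  n%:R * \sum_(s <- parts n) F s =
  \sum_(1 <= k < n.+1) k%:R * \sum_(s <- parts n) (count_mem k s)%:R * F s.
Proof.
under [RHS]eq_bigr do rewrite mulr_sumr.
rewrite exchange_big mulr_sumr /= big_seq [RHS]big_seq.
apply: eq_bigr => s; rewrite mem_parts => /and3P[_ _ /eqP sn].
under eq_bigr do rewrite mulrA -natrM.
by rewrite -mulr_suml -natr_sum -sumn_count sn.
Qed.

(** Strong induction on n: removing one k leaves p(n-k) plus the same sum for n-k, whose multiples
    of k are those of n shifted by k. *)
Lemma sum_count_parts_dvd (n k : nat) : (0 < k)%N ->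
  (\sum_(s <- parts n) count_mem k s =
   \sum_(1 <= i < n.+1 | k %| i) npartitions (n - i))%N.
Proof.
move=> k0; have [m] := ubnP n; elim: m n => // m IHm n; rewrite ltnS => le_nm.
have [ltnk|lekn] := ltnP n k.
  rewrite big_seq big1 => [|s]; last first.
    rewrite mem_parts => /and3P[_ _ /eqP sn]; apply/count_memPn.
    by apply: contraL ltnk => /mem_le_sumn; rewrite -leqNgt sn.
  rewrite big_nat_cond big1 // => i /andP[/andP[i0 lein] /(dvdn_leq i0)].
  by rewrite leqNgt (leq_trans lein).
have kn : (0 < k <= n)%N by rewrite k0.
have -> : (\sum_(s <- parts n) count_mem k s =
    \sum_(s <- parts (n - k)) (count_mem k s + 1))%N.
  (* [sum_count_parts] lives in a ring, so the identity is checked in [int]. *)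
  apply/eqP; rewrite -(eqr_nat int) !natr_sum; apply/eqP.
  have := @sum_count_parts int n k (fun=> 1) kn; congr (_ = _).
    by apply: eq_bigr => s _; rewrite mulr1.
  by apply: eq_bigr => s _; rewrite mulr1 addn1.
rewrite big_split /= sum1_size size_parts IHm; last first.
  by apply: leq_trans le_nm; rewrite ltn_subrL k0 (leq_trans k0).
(* No positive i below k is a multiple of k, and i = k gives p(n-k). *)
rewrite [RHS](@big_cat_nat _ _ _ k) ?leqW //=.
rewrite [X in _ = (X + _)%N]big_nat_cond.
rewrite [X in _ = (X + _)%N]big1 ?add0n; last first.
  by move=> i /andP[/andP[i0 ltik] /(dvdn_leq i0)]; rewrite leqNgt ltik.
rewrite [RHS]big_ltn_cond ?ltnS //= dvdnn [LHS]addnC; congr (_ + _)%N.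
rewrite -[k.+1]add1n big_addn subSn //.
by apply: eq_big => [i|i _]; rewrite ?dvdn_addl // addnC subnDA.
Qed.

(** The bound n does not depend on i, so that the sums over k and i can be exchanged in
    [npartitions_rec]. *)
Lemma sigma_sum (i n : nat) : (0 < i <= n)%N ->
  sigma i = (\sum_(1 <= k < n.+1 | k %| i) k)%N.
Proof.
move=> /andP[i0 lein]; rewrite /sigma -[RHS]big_filter; apply: perm_big.
apply: uniq_perm; rewrite ?divisors_uniq ?filter_uniq ?iota_uniq // => k.
rewrite -dvdn_divisors // mem_filter mem_index_iota.
case ki: (k %| i)%N => //=; rewrite (dvdn_gt0 i0 ki) ltnS.
by rewrite (leq_trans (dvdn_leq i0 ki)).
Qed.

Lemma npartitions_rec (n : nat) :
  (n * npartitions n = \sum_(1 <= k < n.+1) sigma k * npartitions (n - k))%N.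
Proof.
transitivity (\sum_(1 <= k < n.+1) k * \sum_(s <- parts n) count_mem k s)%N.
  apply/eqP; rewrite -(eqr_nat int) natr_sum -size_parts -sum1_size.
  rewrite natrM natr_sum.
  rewrite (sum_parts_mul n (fun=> 1)); apply/eqP/eq_bigr => k _.
  rewrite natrM natr_sum; congr (_ * _).
  by apply: eq_bigr => s _; rewrite mulr1.
rewrite big_nat.
under eq_bigr => k /andP[k0 _] do
  rewrite sum_count_parts_dvd // big_distrr big_mkcond /=.
rewrite -big_nat exchange_big /= big_nat [RHS]big_nat.
apply: eq_bigr => i /andP[i0 lein]; rewrite -big_mkcond /= (@sigma_sum i n) ?i0 //.
by rewrite big_distrl.
Qed.

(** * The sum of the weights of the partitions of n *)

Definition weight (s : seq nat) : rat := (zpart s)%:R^-1 * (sigma_part s)%:R.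

(** The added factors are k^0 0! = 1. A partition and its enlargement by one part can thus be
    compared over the same range. *)
Lemma zpart_bound (s : seq nat) (n : nat) : (sumn s <= n)%N ->
  zpart s = (\prod_(1 <= k < n.+1) (k ^ count_mem k s * (count_mem k s)`!))%N.
Proof.
move=> le_n; rewrite [RHS](@big_cat_nat _ _ _ (sumn s).+1) //=.
rewrite [X in (_ * X)%N]big_nat [X in (_ * X)%N]big1 ?muln1 // => k /andP[ltk _].
have /count_memPn -> : k \notin s.
  by apply: contraL ltk => /mem_le_sumn; rewrite -leqNgt.
by rewrite expn0 fact0.
Qed.

(** Only the factor at k changes, from k^m m! to k^(m+1) (m+1)!. *)
Lemma zpart_insert (k : nat) (s : seq nat) : (0 < k)%N ->
  zpart (insert_part k s) = (k * (count_mem k s).+1 * zpart s)%N.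
Proof.
move=> k0; have pks := perm_insert_part k s.
rewrite (@zpart_bound _ (k + sumn s)); last by rewrite (perm_sumn pks).
rewrite (@zpart_bound s (k + sumn s)) ?leq_addl //.
have kin : k \in index_iota 1 (k + sumn s).+1.
  by rewrite mem_index_iota k0 ltnS leq_addr.
rewrite (bigD1_seq k) ?iota_uniq // [in RHS](bigD1_seq k) ?iota_uniq //=.
rewrite (permP pks) /= eqxx add1n expnS factS.
rewrite (eq_bigr (fun i => i ^ count_mem i s * (count_mem i s)`!)%N); first last.
  by move=> i /negbTE ni; rewrite (permP pks) /= eq_sym ni.
rewrite !mulnA; congr (_ * _ * _)%N; rewrite -!mulnA; congr (_ * _)%N.
exact: mulnC.
Qed.

Lemma sigma_part_insert (k : nat) (s : seq nat) : (0 < k)%N ->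
  sigma_part (insert_part k s) = (sigma k * sigma_part s)%N.
Proof.
move=> k0; rewrite /sigma_part (perm_big _ (perm_insert_part k s)).
by rewrite big_cons k0.
Qed.

Lemma weight_insert (k : nat) (s : seq nat) : (0 < k)%N ->
  k%:R * ((count_mem k s).+1%:R * weight (insert_part k s)) =
  (sigma k)%:R * weight s.
Proof.
move=> k0; rewrite /weight zpart_insert // sigma_part_insert // !natrM !invfM.
have k_neq0 : k%:R != 0 :> rat by rewrite pnatr_eq0 -lt0n.
have c_neq0 : (count_mem k s).+1%:R != 0 :> rat by rewrite pnatr_eq0.
by rewrite -!mulrA (mulrCA _.+1%:R) !mulVKf // mulrCA.
Qed.

Lemma sum_weight_rec (n : nat) :
  n%:R * \sum_(s <- parts n) weight s =
  \sum_(1 <= k < n.+1) (sigma k)%:R * \sum_(s <- parts (n - k)) weight s.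
Proof.
rewrite sum_parts_mul big_nat [RHS]big_nat; apply: eq_bigr => k /andP[k0 lekn].
rewrite sum_count_parts ?k0 // !mulr_sumr.
by apply: eq_bigr => s _; rewrite weight_insert.
Qed.

Lemma parts0 : parts 0 = [:: [::]].
Proof.
apply: perm_small_eq => //; apply: uniq_perm; rewrite ?parts_uniq // => s.
rewrite mem_parts inE; case: s => [|k s] //=.
apply/and3P => -[_]; rewrite inE negb_or eq_sym -lt0n addn_eq0.
by case/andP => k0 _; rewrite eqn0Ngt k0.
Qed.

Lemma npartitions0 : npartitions 0 = 1%N.
Proof. by rewrite -size_parts parts0. Qed.

(** Both sides are 1 at n = 0 and obey the same recurrence, whose factor n+1 can be cancelled in the
    rationals. *)
Lemma npartitions_weight (n : nat) :
  (npartitions n)%:R = \sum_(s <- parts n) weight s.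
Proof.
have [m] := ubnP n; elim: m n => // m IHm [_|n].
  rewrite npartitions0 parts0 big_seq1 /weight.
  by rewrite /zpart /sigma_part big_nil big_geq.
rewrite ltnS => le_nm.
apply: (@mulfI _ n.+1%:R); first by rewrite pnatr_eq0.
rewrite sum_weight_rec -natrM npartitions_rec natr_sum big_nat [RHS]big_nat.
apply: eq_bigr => k /andP[k0 lekn]; rewrite natrM IHm //.
by apply: leq_trans le_nm; rewrite ltn_subrL k0.
Qed.

(** Zeros affect neither the sum nor the multiplicity of any k >= 1, and [sigma_part] skips them; so
    the padding of the tuples is harmless. *)
Lemma weight_posparts (s : seq nat) : weight (posparts s) = weight s.
Proof.
rewrite /weight /zpart /sigma_part sumn_posparts big_filter_cond /=.
congr (_%:R^-1 * _%:R); last by apply: eq_bigl => k; rewrite andbb.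
rewrite big_nat [RHS]big_nat; apply: eq_bigr => k /andP[k0 _].
rewrite /multiplicity count_filter.
have -> : count (predI (pred1 k) (fun i => 0 < i)%N) s = count_mem k s.
  by apply: eq_count => i /=; case: eqP => // ->.
by [].
Qed.

(** * The determinants of J_n and H_n *)

(** Row i of a Hessenberg matrix ends at column i+1, which the last row lacks; there nothing cancels
    the sum up to column i. *)
Lemma sum_ord_split (V : nmodType) (n i : nat) (f : nat -> V) : (i <= n)%N ->
    (forall k, (i.+1 < k)%N -> f k = 0) ->
  \sum_(k < n.+1) f k =
  \sum_(0 <= k < i.+1) f k + (if i == n then 0 else f i.+1).
Proof.
move=> lein f0; rewrite -(big_mkord xpredT) (@big_cat_nat _ _ _ i.+1) //=.
congr (_ + _); have [->|ni] := eqVneq i n; first by rewrite big_geq.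
have ltin : (i.+1 < n.+1)%N by rewrite ltnS ltn_neqAle ni.
rewrite big_ltn // big_nat big1 ?addr0 // => k /andP[ltik _]; exact: f0.
Qed.

Lemma det_Jmx (R : comNzRingType) (n : nat) (j p : nat -> R) : p 0%N = 1 ->
    (forall m, m%:R * p m = \sum_(1 <= k < m.+1) j k * p (m - k)%N) ->
  \det (Jmx n j) = n`!%:R * p n.
Proof.
case: n => [|n] p0 prec; first by rewrite det_mx00 p0 mulr1.
rewrite (@det_hessenberg _ _ _ (\col_i p i) (n.+1%:R * p n.+1)).
- rewrite (eq_bigr (fun i : 'I_n => - i.+1%:R)); last first.
    by move=> i _; rewrite mxE /= /bump /= add1n ltnn eqxx.
  (* The n signs of the superdiagonal entries cancel the (-1)^n of the cofactor, leaving n!. *)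
  rewrite prodrN card_ord mulrACA -natr_prod -exprMn mulrNN mulr1 expr1n mul1r.
  rewrite factS fact_prod big_add1 big_mkord natrM -!mulrA.
  by congr (_ * _); rewrite mulrC.
- by move=> i k ltik; rewrite mxE leqNgt (ltnW ltik) /= gtn_eqF.
- by rewrite mxE.
move=> i; rewrite mxE.
pose f (k : nat) := (if (k <= i)%N then j (i - k).+1
  else if k == i.+1 then - i.+1%:R else 0) * p k.
rewrite (eq_bigr (fun k : 'I_n.+1 => f k)) => [|k _]; last by rewrite !mxE.
have lein : (i <= n)%N by rewrite -ltnS.
rewrite (@sum_ord_split _ n i f lein); last first.
  by move=> k ltik; rewrite /f leqNgt (ltnW ltik) /= gtn_eqF ?mul0r.
have -> : \sum_(0 <= k < i.+1) f k = i.+1%:R * p i.+1.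
  rewrite prec big_add1 big_nat_rev /= big_nat [RHS]big_nat.
  apply: eq_bigr => k ltki; rewrite /f add0n subSS leq_subr.
  by rewrite subKn // subSS.
rewrite -val_eqE /=; case: eqP => [->|_]; first by rewrite addr0.
by rewrite /f ltnn eqxx mulNr subrr.
Qed.

Lemma det_Hmx (R : comNzRingType) (n : nat) (h s : nat -> R) : h 0%N = 1 ->
    (forall m, m%:R * h m = \sum_(1 <= k < m.+1) s k * h (m - k)%N) ->
  \det (Hmx n.+1 h) = (-1) ^+ n * s n.+1.
Proof.
move=> h0 hrec.
pose v (k : nat) := if k == 0%N then 1 else - s k.
rewrite (@det_hessenberg _ _ _ (\col_i v i) (s n.+1)).
- rewrite big1 ?mulr1 // => i _.
  by rewrite mxE /= /bump /= add1n ltnn eqxx.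
- move=> [i ?] [[|k] ?] //= ltik.
  by rewrite mxE /= leqNgt (ltnW ltik) /= gtn_eqF.
- by rewrite mxE.
move=> i; rewrite mxE.
pose f (k : nat) := (if k == 0%N then i.+1%:R * h i.+1
  else if (k <= i)%N then h (i - k).+1 else if k == i.+1 then 1 else 0) * v k.
rewrite (eq_bigr (fun k : 'I_n.+1 => f k)) => [|k _]; last by rewrite !mxE.
have lein : (i <= n)%N by rewrite -ltnS.
rewrite (@sum_ord_split _ n i f lein); last first.
  by move=> [|k] // ltik; rewrite /f leqNgt (ltnW ltik) /= gtn_eqF ?mul0r.
have -> : \sum_(0 <= k < i.+1) f k = s i.+1.
  (* By the recurrence, column 0 contributes the sum of all s_k h_(i+1-k). Its last term is s_(i+1),
     as h_0 = 1; columns 1 to i cancel the others. *)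
  rewrite big_ltn // /f /v /= mulr1 hrec big_nat_recr //= subnn h0 mulr1.
  rewrite addrAC -big_split /= big_nat big1 ?add0r // => -[|k] //= ltki.
  by rewrite -ltnS ltki mulrN subSn // mulrC subrr.
rewrite -val_eqE /=; case: eqP => [->|_]; first by rewrite addr0.
by rewrite /f /v /= ltnn eqxx mul1r subrr.
Qed.

Theorem theorem3p4 (n : nat) (hn : (1 <= n)%N) :
  [/\ n`!%:Z * (npartitions n)%:Z = \det (Jmx n (fun k => (sigma k)%:Z)),
      (sigma n)%:Z =
        (-1) ^+ (n - 1) * \det (Hmx n (fun k => (npartitions k)%:Z))
    & (npartitions n)%:R =
        \sum_(l in partitions n)
          (zpart (map val l))%:R^-1 * (sigma_part (map val l))%:R :> rat].
Proof.
have prec (m : nat) : m%:R * (npartitions m)%:Z =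
    \sum_(1 <= k < m.+1) (sigma k)%:Z * (npartitions (m - k))%:Z.
  rewrite -!natz -natrM npartitions_rec natr_sum.
  by apply: eq_bigr => k _; rewrite natrM !natz.
split.
- rewrite (@det_Jmx _ n (fun k => (sigma k)%:Z) (fun k => (npartitions k)%:Z)) //.
  + by rewrite natz.
  by rewrite npartitions0.
- case: n hn => // n _; rewrite subn1 /=.
  rewrite (@det_Hmx _ n (fun k => (npartitions k)%:Z) (fun k => (sigma k)%:Z)) //.
  + by rewrite mulrA -exprMn mulrNN mulr1 expr1n mul1r.
  by rewrite npartitions0.
- rewrite npartitions_weight big_map big_enum /=.
  by apply: eq_bigr => l _; rewrite weight_posparts.
Qed.
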